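(* Let $(\mathscr{X},\|\cdot\|)$ be a real normed space and let $p\in[0,1)$. Then the following statements are mutually equivalent: (i) For all $q\in(0,1]$ and all nonzero $x,y\in\mathscr{X}$, $$\alpha_{p}[x,y]\leq 2^{\frac{1}{q}}\, \frac {\|x-y\|}{\left(\|x\|^{(1-p)q}+\|y\|^{(1-p)q}\right)^{\frac{1}{q}}}.$$ (ii) There exists a real number $q>0$ such that for all nonzero $x,y\in\mathscr{X}$, $$\alpha_{p}[x,y]\leq 2^{\frac{1}{q}}\, \frac {\|x-y\|}{\left(\|x\|^{(1-p)q}+\|y\|^{(1-p)q}\right)^{\frac{1}{q}}}.$$ (iii) $(\mathscr{X},\|\cdot\|)$ is an inner product space.
   Context: For $p\in\mathbb{R}$ and nonzero elements $x,y$ of a normed space $(\mathscr{X},\|\cdot\|)$, the $p$-angular distance is $$\alpha_{p}[x,y]:=\left\|\frac{x}{\|x\|^{1-p}}-\frac{y}{\|y\|^{1-p}}\right\|.$$ Saying that $(\mathscr{X},\|\cdot\|)$ is an inner product space means that the norm $\|\cdot\|$ is induced by an inner product on $\mathscr{X}$, i.e. there is an inner product $\langle\cdot,\cdot\rangle$ on $\mathscr{X}$ with $\|x\|^2=\langle x,x\rangle$ for all $x\in\mathscr{X}$. No completeness or assumption on the dimension is made. *)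

(* Defs.v *)
From mathcomp Require Export all_boot all_order all_algebra sesquilinear.
From mathcomp Require Export reals normedtype exp.

Set Implicit Arguments.
Unset Strict Implicit.
Unset Printing Implicit Defensive.

Export Order.TTheory GRing.Theory Num.Theory.
Export numFieldNormedType.Exports.

Open Scope ring_scope.

(* Only meaningful for nonzero vectors, the only ones it is applied to below:
   0 `^ a = 0 for a != 0, and 0^-1 = 0. *)
Definition angular_dist (R : realType) (X : normedModType R) (p : R)
    (x y : X) : R :=
  `|(`|x| `^ (1 - p))^-1 *: x - (`|y| `^ (1 - p))^-1 *: y|.

Definition angular_bound (R : realType) (X : normedModType R) (p q : R) :
    Prop :=
  forall x y : X, x != 0 -> y != 0 ->
    angular_dist p x y <=
      2 `^ q^-1 * (`|x - y| /
        (`|x| `^ ((1 - p) * q) + `|y| `^ ((1 - p) * q)) `^ q^-1).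

(* {dot X for idfun} is the type of symmetric bilinear forms X -> X -> R that
   are positive definite, i.e. of real inner products on X. *)
Definition is_inner_product_space (R : realType) (X : normedModType R) : Prop :=
  exists ip : {dot X for idfun}, forall x : X, `|x| ^+ 2 = ip x x.

(* Main.v *)
(* In an inner product space the bound for q = 1 reduces, the inner product
   entering linearly, to antiparallel vectors, where it is Chebyshev's
   inequality (s^p - t^p) (s^(1-p) - t^(1-p)) >= 0; smaller q only increase the
   right-hand side, by monotonicity of power means.

   Conversely, let |x| = |y| = 1. The bound for e^k x and - e^-k y, where power
   means dominate the geometric mean, says that g k := |e^k x + e^-k y|
   satisfies g (p k) <= g k, so g 0 <= g (p^n k) <= g k in the limit (Lorch's
   condition). This makes x + y Birkhoff orthogonal to x - y whenever
   |x| = |y|, which forces strict convexity; hence the midpoints of all chords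
   parallel to v lie on the line of vectors Birkhoff orthogonal to v, and every
   plane has an isometric reflection exchanging any two given vectors of equal
   norm (Ficken's condition). In an orthonormal basis of the plane these are
   Euclidean reflections, so that the norm is Euclidean. *)

From HB Require Import structures.
Require Import Defs.
From mathcomp Require Import ring lra.
From mathcomp Require Import all_classical interval_inference topology.
From mathcomp Require Import normed_module sequences hoelder convex.

Set Implicit Arguments.
Unset Strict Implicit.
Unset Printing Implicit Defensive.

Local Open Scope classical_set_scope.

(** * Coefficients of linear combinations of two vectors *)

Section LinearCombinations.
Context {R : realType} {X : normedModType R}.
Implicit Types (x y u v : X) (a b : R).

(** A relation, so that the closure rules below, applied with unknown [a] and [b], compute the
    coefficients by following the syntax of [u]. *)
Let lincomb_of x y u a b := u = a *: x + b *: y.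

Lemma lincomb_l x y : lincomb_of x y x 1 0.
Proof. by rewrite /lincomb_of scale1r scale0r addr0. Qed.

Lemma lincomb_r x y : lincomb_of x y y 0 1.
Proof. by rewrite /lincomb_of scale1r scale0r add0r. Qed.

Lemma lincombD x y u v a b a' b' :
  lincomb_of x y u a b -> lincomb_of x y v a' b' ->
  lincomb_of x y (u + v) (a + a') (b + b').
Proof. by rewrite /lincomb_of => -> ->; rewrite !scalerDl addrACA. Qed.

Lemma lincombN x y u a b :
  lincomb_of x y u a b -> lincomb_of x y (- u) (- a) (- b).
Proof. by rewrite /lincomb_of => ->; rewrite !scaleNr opprD. Qed.

Lemma lincombZ k x y u a b :
  lincomb_of x y u a b -> lincomb_of x y (k *: u) (k * a) (k * b).
Proof. by rewrite /lincomb_of => ->; rewrite scalerDr !scalerA. Qed.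

Lemma lincomb_eq x y u v a b a' b' :
  lincomb_of x y u a b -> lincomb_of x y v a' b' -> a = a' -> b = b' -> u = v.
Proof. by rewrite /lincomb_of => -> -> -> ->. Qed.

End LinearCombinations.

Ltac lincomb_coef :=
  first [ exact: lincomb_l | exact: lincomb_r
        | refine (lincombD _ _); lincomb_coef
        | refine (lincombN _); lincomb_coef
        | refine (lincombZ _ _); lincomb_coef ].

(* Reduces an equality of linear combinations of x and y to the equalities of
   their coefficients. *)
Ltac lincomb x y :=
  refine (@lincomb_eq _ _ x y _ _ _ _ _ _ _ _ _ _);
  [ lincomb_coef | lincomb_coef | .. ].

(** * From a norm that is quadratic on planes to an inner product *)

Section InnerProduct.
Context {R : realType} {X : normedModType R}.
Implicit Types (x y z u v : X) (a b c s t : R).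

Definition polarization x y : R := (`|x + y| ^+ 2 - `|x - y| ^+ 2) / 4.

Lemma sqr_normZ x a : `|a *: x| ^+ 2 = a ^+ 2 * `|x| ^+ 2.
Proof. by rewrite normrZ exprMn real_normK ?num_real. Qed.

Hypothesis planar : forall x y, exists B, forall s t,
  `|s *: x + t *: y| ^+ 2 =
  s ^+ 2 * `|x| ^+ 2 + 2 * s * t * B + t ^+ 2 * `|y| ^+ 2.

Lemma planar_polarization x y s t :
  `|s *: x + t *: y| ^+ 2 =
  s ^+ 2 * `|x| ^+ 2 + 2 * s * t * polarization x y + t ^+ 2 * `|y| ^+ 2.
Proof.
have [B hB] := planar x y; rewrite hB /polarization.
have := hB 1 1; have := hB 1 (-1).
by rewrite scaleN1r !scale1r => -> ->; field.
Qed.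

Lemma polarizationC x y : polarization x y = polarization y x.
Proof. by rewrite /polarization [x + y]addrC distrC. Qed.

Lemma polarizationxx x : polarization x x = `|x| ^+ 2.
Proof.
by rewrite /polarization subrr normr0 -mulr2n -scaler_nat sqr_normZ; field.
Qed.

Lemma polarizationZ a x y : polarization (a *: x) y = a * polarization x y.
Proof.
have := planar_polarization x y a 1; have := planar_polarization x y a (-1).
rewrite scaleN1r scale1r => h1 h2.
by rewrite [LHS]/polarization h1 h2; field.
Qed.

(** Jordan-von Neumann: in [e1 + e2 - e3 - e4] the norms of [x + z - y] and [y + z - x] cancel. *)
Lemma polarizationD x y z :
  polarization (x + y) z = polarization x z + polarization y z.
Proof.
have para u v : `|u + v| ^+ 2 + `|u - v| ^+ 2 = 2 * `|u| ^+ 2 + 2 * `|v| ^+ 2.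
  have := planar_polarization u v 1 1; have := planar_polarization u v 1 (-1).
  by rewrite scaleN1r !scale1r => -> ->; ring.
rewrite /polarization.
have e1 := para (x + z) y; have e2 := para (y + z) x.
have e3 := para (x - z) y; have e4 := para (y - z) x.
have f1 : x + z + y = x + y + z by rewrite addrAC.
have f2 : y + z + x = x + y + z by rewrite addrAC [y + x]addrC.
have f3 : x - z + y = x + y - z by rewrite addrAC.
have f4 : y - z + x = x + y - z by rewrite addrAC [y + x]addrC.
have f5 : `|y - z - x| = `|x + z - y|.
  by rewrite -normrN !opprB [in LHS]addrA.
have f6 : `|x - z - y| = `|y + z - x|.
  by rewrite -normrN !opprB [in LHS]addrA.
rewrite f1 in e1; rewrite f2 in e2; rewrite f3 f6 in e3; rewrite f4 f5 in e4.
lra.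
Qed.

Lemma inner_product_of_planar : is_inner_product_space X.
Proof.
have bil : bilinear_for *%R (idfun \; *%R) polarization.
  split=> [z a u v|z a u v] /=.
    by rewrite polarizationD polarizationZ.
  by rewrite ![polarization z _]polarizationC polarizationD polarizationZ.
have herm x y : polarization x y = (-1) ^+ false * idfun (polarization y x).
  by rewrite expr0 mul1r polarizationC.
have pos x : x != 0 -> 0 < polarization x x.
  by move=> x0; rewrite polarizationxx exprn_gt0// normr_gt0.
pose m1 :=
  bilinear_isBilinear.Build R X X R *%R (idfun \; *%R) polarization bil.
pose m2 := isHermitianSesquilinear.Build R X false idfun polarization herm.
pose m3 := isDotProduct.Build R X polarization pos.
pose ip : {dot X for idfun} := HB.pack polarization m1 m2 m3.
by exists ip => x; rewrite -polarizationxx.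
Qed.

End InnerProduct.

(** Homogeneous form of Lorch's condition, which is the case [b = a^-1]; squaring avoids the root of
    [a * b]. *)
Definition lorch (R : realType) (X : normedModType R) :=
  forall (x y : X) (a b : R), `|x| = `|y| -> 0 < a -> 0 < b ->
  a * b * `|x + y| ^+ 2 <= `|a *: x + b *: y| ^+ 2.

(** * Birkhoff orthogonality, strict convexity and reflections *)

Section Orthogonality.
Context {R : realType} {X : normedModType R}.
Implicit Types (x y u v : X) (a b s t : R).

Definition birkhoff u v := forall s : R, `|u| <= `|u + s *: v|.

(** For [a = 1 + s], [b = 1 - s] the norm of [u + s *: v] falls below that of [u] by at most order
    [s ^+ 2]; convexity in [s] then excludes any drop. *)
Lemma lorch_birkhoff x y : lorch X -> `|x| = `|y| -> birkhoff (x + y) (x - y).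
Proof.
move=> lo xy; set u := x + y; set v := x - y.
have sqr_bound s : -1 < s < 1 -> (1 - s ^+ 2) * `|u| <= `|u + s *: v|.
  move=> /andP[s1 s2]; have := lo x y (1 + s) (1 - s) xy.
  have -> : (1 + s) *: x + (1 - s) *: y = u + s *: v.
    by rewrite /u /v; lincomb x y; ring.
  have p1 : 0 < 1 + s by lra. have p2 : 0 < 1 - s by lra.
  move=> /(_ p1 p2) h.
  have k0 : 0 <= 1 - s ^+ 2 by nra.
  have k1 : 1 - s ^+ 2 <= 1 by nra.
  rewrite -(@ler_pXn2r _ 2) ?nnegrE ?mulr_ge0//.
  apply: le_trans h; rewrite exprMn ler_wpM2r ?exprn_ge0//; nra.
move=> s; apply/ler_addgt0Pl => e e0.
(* Large enough that [s / k] lies in [(-1, 1)] and the quadratic loss, rescaled by [k], is at most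
   [e]. *)
pose k := 1 + `|s| + s ^+ 2 * `|u| / e.
have c0 : 0 <= s ^+ 2 * `|u| / e.
  exact: (divr_ge0 (mulr_ge0 (sqr_ge0 s) (normr_ge0 u)) (ltW e0)).
have k1 : 1 <= k by have := normr_ge0 s; rewrite /k; lra.
have k0 : 0 < k by lra.
have hs : `|s / k| < 1.
  rewrite normrM (@ger0_norm _ k^-1) ?invr_ge0 ?(ltW k0)//.
  by rewrite ltr_pdivrMr// mul1r /k; lra.
have := sqr_bound (s / k); rewrite -ltr_norml => /(_ hs) h.
have h2 : `|u + (s / k) *: v| <= (1 - k^-1) * `|u| + k^-1 * `|u + s *: v|.
  have -> : u + (s / k) *: v = (1 - k^-1) *: u + k^-1 *: (u + s *: v).
    by lincomb u v; field; rewrite gt_eqF.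
  have kk : k^-1 <= 1 by rewrite invf_le1.
  apply: (le_trans (ler_normD _ _)); rewrite !normrZ !ger0_norm ?subr_ge0//.
  by rewrite invr_ge0 (ltW k0).
have := le_trans h h2.
have -> : 1 - (s / k) ^+ 2 = 1 - s ^+ 2 / k * k^-1.
  by field; rewrite gt_eqF.
rewrite !mulrBl !mul1r -addrA lerD2l => {}h.
have h3 : `|u| - s ^+ 2 / k * `|u| <= `|u + s *: v|.
  have := ler_wpM2l (ltW k0) h; rewrite mulrDr !mulrN [k * (k^-1 * _)]mulrA.
  rewrite mulfV ?gt_eqF// mul1r mulrA [k * (k^-1 * _)]mulrA.
  rewrite mulfV ?gt_eqF// mul1r.
  have -> : k * (s ^+ 2 / k * k^-1) = s ^+ 2 / k by field; rewrite gt_eqF.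
  by lra.
have : s ^+ 2 / k * `|u| <= e.
  rewrite mulrAC ler_pdivrMr// /k !mulrDr mulr1 [e * (_ / e)]mulrC.
  rewrite divfK ?gt_eqF//.
  have := mulr_ge0 (ltW e0) (normr_ge0 s); lra.
by lra.
Qed.

Hypothesis iso_birkhoff : forall x y, `|x| = `|y| -> birkhoff (x + y) (x - y).

(** For [s <= t], the reverse triangle inequality for [t *: (x + y)] and [(t - s) *: x] gives the
    lower bound. *)
Lemma norm_comb_segment x y s t : `|x| = `|y| -> `|x + y| = 2 * `|x| ->
  0 <= s -> 0 <= t -> `|s *: x + t *: y| = (s + t) * `|x|.
Proof.
wlog st : x y s t / s <= t => [hw xy e s0 t0|xy e s0 t0].
  have [/hw|/ltW ts] := leP s t; first exact.
  by rewrite addrC hw// ?(addrC y) -?xy// (addrC t).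
apply/eqP; rewrite eq_le; apply/andP; split.
  rewrite (le_trans (ler_normD _ _))// !normrZ !ger0_norm// -xy; lra.
have -> : s *: x + t *: y = t *: (x + y) - (t - s) *: x.
  by lincomb x y; ring.
rewrite (le_trans _ (lerB_dist _ _))// !normrZ !ger0_norm ?subr_ge0// e; lra.
Qed.

(* If x, y span a segment of a sphere that does not extend to 2 y - x, the
   chord from x to the sphere point above 2 y - x has its midpoint over the
   interior of the segment, but is not parallel to it. *)
Lemma segment_extends x y : `|x| = `|y| -> `|x + y| = 2 * `|x| ->
  `|2 *: y - x| = `|x|.
Proof.
move=> xy e; have y2 : `|2 *: y| = 2 * `|x| by rewrite normrZ ger0_norm// xy.
apply/eqP; rewrite eq_le; apply/andP; split; last first.
  by rewrite (le_trans _ (lerB_dist _ _))// y2; lra.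
rewrite leNgt; apply/negP => N; set z := 2 *: y - x in N.
have z0 : 0 < `|z| by rewrite (le_lt_trans _ N).
pose k : R := `|x| / `|z|; have k0 : 0 <= k by rewrite divr_ge0.
have k1 : k < 1 by rewrite ltr_pdivrMr// mul1r.
have kz : `|k *: z| = `|x| by rewrite normrZ ger0_norm// divfK// gt_eqF.
(* This scalar removes the [x] component; orthogonality then reads [(1 + k) ^+ 2 <= 4 * k], against
   [k < 1]. *)
have := iso_birkhoff (esym kz) (- ((1 - k) / (1 + k))).
have -> : x + k *: z = (1 - k) *: x + (2 * k) *: y.
  by rewrite /z; lincomb x y; ring.
have -> : (1 - k) *: x + (2 * k) *: y + - ((1 - k) / (1 + k)) *: (x - k *: z)
    = 0 *: x + (4 * k / (1 + k)) *: y.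
  by rewrite /z; lincomb x y; field; rewrite gt_eqF//; lra.
have p1 : 0 < 1 + k by lra.
have p2 : 0 <= 4 * k / (1 + k).
  exact: (divr_ge0 (mulr_ge0 (ler0n _ 4) k0) (ltW p1)).
have x0 : 0 < `|x|.
  have := ler_normB (2 *: y) x; rewrite -/z y2; lra.
have k2 : 0 <= 2 * k by lra. have k3 : 0 <= 1 - k by lra.
rewrite (norm_comb_segment xy e k3 k2) (norm_comb_segment xy e (lexx 0) p2).
rewrite add0r ler_pM2r// ler_pdivlMr// => h.
have : 0 < (1 - k) ^+ 2 by rewrite exprn_gt0// subr_gt0.
by lra.
Qed.

(** Replacing [y] by [2 *: y - x] preserves the hypotheses and doubles [y - x], but a sphere is
    bounded. *)
Lemma strictly_convex x y : `|x| = `|y| -> `|x + y| = 2 * `|x| -> x = y.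
Proof.
have bound n : forall x y, `|x| = `|y| -> `|x + y| = 2 * `|x| ->
    2 ^+ n * `|y - x| <= 2 * `|x|.
  elim: n => [|n IH] {}x {}y xy e.
    by rewrite expr0 mul1r (le_trans (ler_normB _ _))// -xy; lra.
  have e' := segment_extends xy e.
  have := IH x (2 *: y - x) (esym e').
  have -> : x + (2 *: y - x) = 2 *: y by lincomb x y; ring.
  have -> : 2 *: y - x - x = 2 *: (y - x) by lincomb x y; ring.
  by rewrite !normrZ ger0_norm// xy => /(_ erefl); rewrite mulrA exprSr.
move=> xy e; apply/esym/eqP; rewrite -subr_eq0 -normr_eq0 eq_le normr_ge0 andbT.
rewrite leNgt; apply/negP => d0.
have := bound (Num.bound (2 * `|x| / `|y - x|)) x y xy e.
by apply/negP; rewrite -ltNge -ltr_pdivrMr// upper_nthrootP.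
Qed.

(** Equality would put [u] and [u + s *: v] on one sphere with a midpoint no shorter than [u],
    against strict convexity. *)
Lemma birkhoff_strict u v s :
  birkhoff u v -> s *: v != 0 -> `|u| < `|u + s *: v|.
Proof.
move=> uv sv; rewrite lt_neqAle uv andbT; apply/negP => /eqP e.
have : `|u + (u + s *: v)| = 2 * `|u|.
  apply/eqP; rewrite eq_le; apply/andP; split.
    by rewrite (le_trans (ler_normD _ _))// -e; lra.
  have -> : u + (u + s *: v) = 2 *: (u + (s / 2) *: v).
    by lincomb u v; field.
  by rewrite normrZ ger0_norm// ler_pM2l.
move=> /(strictly_convex e)/eqP.
by rewrite addrC -subr_eq subrr eq_sym (negPf sv).
Qed.

(* The chord through u + s v parallel to v ends at some u - t v, and its
   midpoint is Birkhoff orthogonal to v; by strict convexity u is the only such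
   point on u + R v, so s = t. *)
Lemma birkhoff_sym u v s : birkhoff u v -> `|u + s *: v| = `|u - s *: v|.
Proof.
wlog s0 : s / 0 <= s => [hw uv|].
  have [/hw->//|/ltW s0] := leP 0 s.
  by have := hw (- s); rewrite oppr_ge0 !scaleNr opprK => /(_ s0 uv) ->.
move=> uv; have [->|v0] := eqVneq v 0; first by rewrite scaler0 subr0 addr0.
have vp : 0 < `|v| by rewrite normr_gt0.
pose r := `|u + s *: v|; pose f (t : R) := `|u - t *: v|.
have rp : `|u| <= r by exact: uv.
(* The reverse triangle inequality gives [f M >= r] for this [M]. *)
pose M := (r + `|u|) / `|v|.
have M0 : 0 <= M.
  exact: divr_ge0 (addr_ge0 (normr_ge0 _) (normr_ge0 _)) (normr_ge0 _).
have fM : r <= f M.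
  rewrite /f distrC (le_trans _ (lerB_dist _ _))// normrZ ger0_norm//.
  by rewrite /M divfK ?gt_eqF//; lra.
have f0 : f 0 <= r by rewrite /f scale0r subr0.
have fc : continuous f.
  move=> t; apply: (@continuous_comp _ _ _ (fun t : R => u - t *: v) Num.norm).
    apply: cvgB; first exact: cvg_cst.
    by apply: cvgZr_tmp; exact: cvg_id.
  exact: norm_continuous.
have [|t] := @IVT R f 0 M r M0 (continuous_subspaceT fc).
  by rewrite ge_min f0 le_max fM orbT.
rewrite in_itv /= => /andP[t0 _] ft.
have [->|ts] := eqVneq s 0; first by rewrite scale0r subr0 addr0.
have sp : 0 < s by rewrite lt_neqAle eq_sym ts.
have st0 : 0 < s + t by lra.
suff e : s = t by rewrite [in RHS]e; exact: esym ft.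
apply/eqP; rewrite -subr_eq0; apply/negPn/negP => st.
have := birkhoff_strict uv (s := (s - t) / 2).
rewrite scaler_eq0 negb_or v0 mulf_neq0 ?invr_eq0 ?pnatr_eq0//= => /(_ isT).
apply/negP; rewrite -leNgt.
(* This multiple of the chord moves twice its midpoint to [2 *: u], so the midpoint would be no
   longer than [u]. *)
have := iso_birkhoff (esym ft) (- ((s - t) / (s + t))).
have -> : u + s *: v + (u - t *: v) = 2 *: (u + ((s - t) / 2) *: v).
  by lincomb u v; field.
have -> : 2 *: (u + ((s - t) / 2) *: v) +
    - ((s - t) / (s + t)) *: (u + s *: v - (u - t *: v)) = 2 *: u.
  by lincomb u v; field; rewrite gt_eqF.
by rewrite !normrZ ger0_norm// ler_pM2l.
Qed.

Lemma birkhoff_symZ u v s t : birkhoff u v ->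
  `|s *: u + t *: v| = `|s *: u - t *: v|.
Proof.
move=> uv; have [->|s0] := eqVneq s 0.
  by rewrite !scale0r sub0r add0r normrN.
have -> : s *: u + t *: v = s *: (u + (t / s) *: v).
  by lincomb u v; field.
have -> : s *: u - t *: v = s *: (u - (t / s) *: v).
  by lincomb u v; field.
by rewrite !normrZ birkhoff_sym.
Qed.

(** Exchanging [a] and [b] keeps the component along [x + y] and negates the one along [x - y]. *)
Lemma ficken x y a b : `|x| = `|y| -> `|a *: x + b *: y| = `|b *: x + a *: y|.
Proof.
move=> xy.
have -> : a *: x + b *: y =
    ((a + b) / 2) *: (x + y) + ((a - b) / 2) *: (x - y).
  by lincomb x y; field.
have -> : b *: x + a *: y =
    ((a + b) / 2) *: (x + y) - ((a - b) / 2) *: (x - y).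
  by lincomb x y; field.
exact/birkhoff_symZ/iso_birkhoff.
Qed.

(** * Euclidean planes *)

Section Plane.
Variables e f : X.
Hypothesis norm_ef : `|e| = `|f|.
Hypothesis ef : birkhoff e f.

Let swap a b : `|a *: e + b *: f| = `|b *: e + a *: f|.
Proof. exact: ficken. Qed.

Let flip a b : `|a *: e + b *: f| = `|a *: e - b *: f|.
Proof. exact: birkhoff_symZ. Qed.

(* With w = e + (s e + t f) and w' its rotation by a right angle, the
   reflection fixing w and negating w' is an isometry that sends e to
   s e + t f. *)
Lemma norm_on_circle s t : s ^+ 2 + t ^+ 2 = 1 -> `|s *: e + t *: f| = `|e|.
Proof.
move=> st; have [s1|s1] := eqVneq (1 + s) 0.
  have sE : s = -1 by lra.
  have /eqP : t ^+ 2 = 0 by rewrite sE in st; lra.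
  rewrite sqrf_eq0 => /eqP ->.
  by rewrite sE scaleN1r scale0r addr0 normrN.
pose w := (1 + s) *: e + t *: f; pose w' := (- t) *: e + (1 + s) *: f.
have orth a b : `|a *: w + b *: w'| = `|a *: w - b *: w'|.
  have pq : `|2^-1 *: (w + w')| = `|2^-1 *: (w - w')|.
    rewrite !normrZ; congr (_ * _).
    have -> : w + w' = (1 + s - t) *: e + (1 + s + t) *: f.
      by rewrite /w /w'; lincomb e f; ring.
    have -> : w - w' = (1 + s + t) *: e - (1 + s - t) *: f.
      by rewrite /w /w'; lincomb e f; ring.
    by rewrite swap flip.
  have := birkhoff_symZ a b (iso_birkhoff pq).
  have -> : 2^-1 *: (w + w') + 2^-1 *: (w - w') = w.
    by lincomb w w'; field.
  have -> // : 2^-1 *: (w + w') - 2^-1 *: (w - w') = w'.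
  by lincomb w w'; field.
(* The coordinates of [e] in the basis [w], [w']; negating the second one yields
   [s *: e + t *: f]. *)
have := orth 2^-1 (- t / (2 * (1 + s))).
have -> : 2^-1 *: w + (- t / (2 * (1 + s))) *: w' =
    ((1 + 2 * s + (s ^+ 2 + t ^+ 2)) / (2 * (1 + s))) *: e + 0 *: f.
  by rewrite /w /w'; lincomb e f; field.
have -> : 2^-1 *: w - (- t / (2 * (1 + s))) *: w' =
    ((1 + 2 * s + s ^+ 2 - t ^+ 2) / (2 * (1 + s))) *: e + t *: f.
  by rewrite /w /w'; lincomb e f; field.
have -> : (1 + 2 * s + s ^+ 2 - t ^+ 2) / (2 * (1 + s)) = s.
  have -> : t ^+ 2 = 1 - s ^+ 2 by lra.
  by field.
rewrite st scale0r addr0.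
have -> : (1 + 2 * s + 1) / (2 * (1 + s)) = 1 by field.
by rewrite scale1r.
Qed.

Lemma pythagoras s t : `|s *: e + t *: f| ^+ 2 = (s ^+ 2 + t ^+ 2) * `|e| ^+ 2.
Proof.
have st0 : 0 <= s ^+ 2 + t ^+ 2 by rewrite addr_ge0 ?sqr_ge0.
have [/eqP|st] := eqVneq (s ^+ 2 + t ^+ 2) 0.
  rewrite paddr_eq0 ?sqr_ge0// !sqrf_eq0 => /andP[/eqP -> /eqP ->].
  by rewrite !scale0r addr0 normr0 expr0n /= addr0 mul0r.
pose r := Num.sqrt (s ^+ 2 + t ^+ 2).
have r2 : r ^+ 2 = s ^+ 2 + t ^+ 2 by rewrite sqr_sqrtr.
have r0 : r != 0 by rewrite -sqrf_eq0 r2.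
have -> : s *: e + t *: f = r *: ((s / r) *: e + (t / r) *: f).
  by lincomb e f; field.
rewrite sqr_normZ norm_on_circle ?r2//.
by rewrite !expr_div_n -mulrDl -r2 divff// sqrf_eq0.
Qed.

End Plane.

Lemma birkhoff_scale u v a b : birkhoff u v -> birkhoff (a *: u) (b *: v).
Proof.
move=> uv s; have [->|a0] := eqVneq a 0; first by rewrite scale0r normr0.
have -> : a *: u + s *: (b *: v) = a *: (u + (s * b / a) *: v).
  by lincomb u v; field.
by rewrite !normrZ ler_pM2l ?normr_gt0.
Qed.

Lemma pythagoras_iso x y a b : `|x| = `|y| ->
  `|a *: (x + y) + b *: (x - y)| ^+ 2 =
  a ^+ 2 * `|x + y| ^+ 2 + b ^+ 2 * `|x - y| ^+ 2.
Proof.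
move=> xy; have := iso_birkhoff xy; move: (x + y) (x - y) => u v uv.
have [->|u0] := eqVneq u 0.
  by rewrite scaler0 add0r normr0 sqr_normZ expr0n /= mulr0 add0r.
have [->|v0] := eqVneq v 0.
  by rewrite scaler0 addr0 normr0 sqr_normZ expr0n /= mulr0 addr0.
have nu : `|u| != 0 by rewrite normr_eq0.
have nv : `|v| != 0 by rewrite normr_eq0.
have unit (w : X) : `|w| != 0 -> `| `|w|^-1 *: w| = 1.
  by move=> w0; rewrite normrZ normfV normr_id mulVf.
have := pythagoras _ (birkhoff_scale `|u|^-1 `|v|^-1 uv) (a * `|u|) (b * `|v|).
rewrite !unit// => /(_ erefl).
by rewrite !scalerA !mulfK// expr1n mulr1 !exprMn.
Qed.

Lemma iso_birkhoff_inner : is_inner_product_space X.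
Proof.
apply: inner_product_of_planar => x y.
have [->|x0] := eqVneq x 0.
  exists 0 => s t; rewrite scaler0 add0r normr0 sqr_normZ; ring.
have [->|y0] := eqVneq y 0.
  exists 0 => s t; rewrite scaler0 addr0 normr0 sqr_normZ; ring.
have nx : `|x| != 0 by rewrite normr_eq0.
have ny : `|y| != 0 by rewrite normr_eq0.
have xy : `| `|y| *: x| = `| `|x| *: y| by rewrite !normrZ !normr_id mulrC.
have py a b := pythagoras_iso a b xy.
set p := _ + _ in py; set q := _ - _ in py.
have pyx : (2 * `|x| * `|y|) ^+ 2 = `|p| ^+ 2 + `|q| ^+ 2.
  have := py 1 1; rewrite expr1n !mul1r => <-.
  have -> : 1 *: p + 1 *: q = (2 * `|y|) *: x.
    by rewrite /p /q; lincomb x y; ring.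
  by rewrite sqr_normZ; ring.
(* The polarization of the two rescaled vectors of equal norm, with the rescaling divided out. *)
exists ((`|p| ^+ 2 - `|q| ^+ 2) / (4 * `|x| * `|y|)) => s t.
have -> : s *: x + t *: y = ((s / `|y| + t / `|x|) / 2) *: p +
    ((s / `|y| - t / `|x|) / 2) *: q.
  by rewrite /p /q; lincomb x y; field; rewrite ?nx ?ny.
rewrite py.
have -> : `|q| ^+ 2 = (2 * `|x| * `|y|) ^+ 2 - `|p| ^+ 2 by rewrite pyx; ring.
by field; rewrite nx ny.
Qed.

End Orthogonality.

(** * From the angular bound to Lorch's condition *)

(* For s = e^k, t = e^-k the mean of s^(1-p) and t^(1-p) is at least
   their geometric mean 1, whatever q is. *)
Lemma angular_bound_contract (R : realType) (X : normedModType R) (p q k : R)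
    (x y : X) : 0 < q -> angular_bound X p q -> `|x| = 1 -> `|y| = 1 ->
  `|expR (p * k) *: x + expR (- (p * k)) *: y| <=
  `|expR k *: x + expR (- k) *: y|.
Proof.
move=> q0 ab x1 y1.
have nZ c (z : X) : `|z| = 1 -> `|expR c *: z| = expR c.
  by move=> z1; rewrite normrZ z1 mulr1 ger0_norm// expR_ge0.
have nz c (z : X) : `|z| = 1 -> expR c *: z != 0.
  by move=> z1; rewrite -normr_gt0 nZ// expR_gt0.
have yN : `|- y| = 1 by rewrite normrN.
have := ab _ _ (nz k _ x1) (nz (- k) _ yN).
rewrite /angular_dist !nZ// -!expRM -!expRN !scalerA -!expRD scalerN !opprK.
have -> : - (k * (1 - p)) + k = p * k by ring.
have -> : - (- k * (1 - p)) + - k = - (p * k) by ring.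
rewrite scalerN opprK => h; apply: (le_trans h).
rewrite mulrCA ler_piMr//.
set S := _ + _.
have S2 : 2 <= S.
  rewrite /S mulNr expRN; move: (expR_gt0 (k * ((1 - p) * q))).
  move: (expR _) => c c0; rewrite -subr_ge0.
  have -> : c + c^-1 - 2 = (c - 1) ^+ 2 / c by field; rewrite gt_eqF.
  by rewrite divr_ge0 ?sqr_ge0// ltW.
rewrite ler_pdivrMr ?mul1r ?powR_gt0 ?(lt_le_trans _ S2)//.
by rewrite ge0_ler_powR// ?nnegrE ?invr_ge0 ?(le_trans _ S2)// ltW.
Qed.

Lemma angular_bound_lorch (R : realType) (X : normedModType R) (p q : R) :
  0 <= p -> p < 1 -> 0 < q -> angular_bound X p q -> lorch X.
Proof.
move=> p0 p1 q0 ab.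
have unit (x y : X) k : `|x| = 1 -> `|y| = 1 ->
    `|x + y| <= `|expR k *: x + expR (- k) *: y|.
  move=> x1 y1; pose f (c : R) := `|expR c *: x + expR (- c) *: y|.
  have iter n : f (p ^+ n * k) <= f k.
    elim: n => [|n]; first by rewrite expr0 mul1r.
    apply: le_trans; rewrite exprS -mulrA.
    exact: (angular_bound_contract _ q0 ab x1 y1).
  have fc : continuous f.
    move=> c; apply: (@continuous_comp _ _ _
      (fun c : R => expR c *: x + expR (- c) *: y) Num.norm).
      apply: cvgD; apply: cvgZr_tmp; first exact: continuous_expR.
      apply: (@continuous_comp _ _ _ (fun c : R => - c) expR).
        exact: opp_continuous.
      exact: continuous_expR.
    exact: norm_continuous.
  have lim0 : (fun n => p ^+ n * k) @ \oo --> (0 : R).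
    rewrite -[X in _ --> X](mul0r k); apply: cvgMr_tmp.
    by apply: cvg_expr; rewrite ger0_norm.
  have := cvg_comp _ _ lim0 (fc 0) => flim.
  have -> : `|x + y| = f 0 by rewrite /f oppr0 expR0 !scale1r.
  rewrite -(cvg_lim _ flim)//; apply: limr_le.
    by apply/cvg_ex; exists (f 0).
  by apply: nearW => n; exact: iter.
move=> x y a b xy a0 b0.
have [x0|x0] := eqVneq x 0.
  move: xy; rewrite x0 normr0 => /esym/eqP; rewrite normr_eq0 => /eqP ->.
  by rewrite addr0 normr0 expr0n /= mulr0 exprn_ge0.
have nx : `|x| != 0 by rewrite normr_eq0.
have ny : `|y| != 0 by rewrite -xy.
have r0 : 0 < `|x| by rewrite normr_gt0.
have unitn (z : X) : `|z| = `|x| -> `| `|x|^-1 *: z| = 1.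
  by move=> zx; rewrite normrZ normfV normr_id zx mulVf.
(* [expR m] is the geometric mean of [a] and [b]; dividing by it leaves coefficients with product
   1. *)
pose k := (ln a - ln b) / 2; pose m := (ln a + ln b) / 2.
have ea : expR m * expR k = a.
  by rewrite -expRD -[RHS](lnK a0) /m /k; congr expR; field.
have eb : expR m * expR (- k) = b.
  by rewrite -expRD -[RHS](lnK b0) /m /k; congr expR; field.
have := unit _ _ k (unitn x erefl) (unitn y (esym xy)).
have -> : `|x|^-1 *: x + `|x|^-1 *: y = `|x|^-1 *: (x + y) by rewrite scalerDr.
have -> : expR k *: (`|x|^-1 *: x) + expR (- k) *: (`|x|^-1 *: y) =
    `|x|^-1 *: (expR k *: x + expR (- k) *: y).
  by lincomb x y; ring.
rewrite !normrZ ler_pM2l ?normr_gt0 ?invr_eq0// => h.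
have -> : a *: x + b *: y = expR m *: (expR k *: x + expR (- k) *: y).
  by rewrite -ea -eb; lincomb x y; ring.
have -> : a * b = expR m ^+ 2.
  rewrite -ea -eb; have := expRxMexpNx_1 k.
  by rewrite mulrACA => ->; rewrite mulr1.
by rewrite sqr_normZ ler_pM2l ?exprn_gt0 ?expR_gt0// ler_pXn2r ?nnegrE.
Qed.

(** * The angular bound in inner product spaces *)

Lemma power_mean_le (R : realType) (a b q : R) : 0 < a -> 0 < b -> 0 < q ->
  q <= 1 -> (a `^ q + b `^ q) `^ q^-1 <= 2 `^ q^-1 * ((a + b) / 2).
Proof.
move=> a0 b0 q0 q1.
have r1 : 1 <= q^-1 by rewrite invf_ge1.
have A0 : 0 <= a `^ q by exact: powR_ge0.
have B0 : 0 <= b `^ q by exact: powR_ge0.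
have h2 : 0 <= 2^-1 :> R by lra.
have h21 : 2^-1 <= 1 :> R by lra.
have K c : 0 < c -> (c `^ q) `^ q^-1 = c.
  by move=> c0; rewrite -powRrM divff ?gt_eqF// powRr1// ltW.
have half c d : 2^-1 * c + (1 - 2^-1) * d = 2^-1 * (c + d) :> R by field.
(* Midpoint convexity of the power with exponent [q^-1 >= 1]. *)
have h : (2^-1 * a `^ q + (1 - 2^-1) * b `^ q) `^ q^-1 <=
         2^-1 * (a `^ q) `^ q^-1 + (1 - 2^-1) * (b `^ q) `^ q^-1.
  by apply: (convex_powR r1 (Itv01 h2 h21)); rewrite inE /= in_itv /= andbT.
move: h; rewrite !half !K// powRM ?addr_ge0// => h.
rewrite -(@ler_pM2l _ (2^-1 `^ q^-1)) ?powR_gt0//.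
rewrite [X in _ <= X]mulrA -[X in _ <= X * _]powRM// mulVf ?pnatr_eq0//.
by rewrite powR1 mul1r [X in _ <= X]mulrC.
Qed.

Lemma angular_bound_inner (R : realType) (X : normedModType R) (p q : R) :
  0 <= p -> p < 1 -> 0 < q -> q <= 1 -> is_inner_product_space X ->
  angular_bound X p q.
Proof.
move=> p0 p1 q0 q1 [ip ipE] x y x0 y0; rewrite /angular_dist.
have : 0 < `|x| by rewrite normr_gt0. have : 0 < `|y| by rewrite normr_gt0.
set s := `|x|; set t := `|y| => t0 s0.
rewrite !powRrM; set a := s `^ (1 - p); set b := t `^ (1 - p).
have a0 : 0 < a by exact: powR_gt0. have b0 : 0 < b by exact: powR_gt0.
have ab0 : 0 < (a `^ q + b `^ q) `^ q^-1.
  by rewrite powR_gt0// addr_gt0// powR_gt0.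
rewrite mulrA ler_pdivlMr//.
apply: (@le_trans _ _ (`|a^-1 *: x - b^-1 *: y| * (2 `^ q^-1 * ((a + b) / 2)))).
  by rewrite ler_wpM2l// power_mean_le.
rewrite mulrCA ler_pM2l ?powR_gt0//.
have abh : 0 <= (a + b) / 2 by lra.
rewrite -(@ler_pXn2r _ 2) ?nnegrE ?(mulr_ge0 _ abh)//.
have E (k l : R) : `|k *: x - l *: y| ^+ 2 =
    k ^+ 2 * s ^+ 2 - 2 * k * l * ip x y + l ^+ 2 * t ^+ 2.
  rewrite !ipE linearBl !linearB /= !linearZl_LR !linearZr_LR /=.
  have -> : ip y x = ip x y.
    by have := hermitian_subproof (s := ip) y x; rewrite expr0 mul1r => ->.
  by ring.
(* The norms of the rescaled vectors [a^-1 *: x] and [b^-1 *: y]. *)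
pose S := s `^ p; pose T := t `^ p.
have sE : s = a * S by rewrite /a /S -powRD ?subrK ?powRr1 ?ltW// oner_eq0.
have tE : t = b * T by rewrite /b /T -powRD ?subrK ?powRr1 ?ltW// oner_eq0.
have S0 : 0 < S by exact: powR_gt0. have T0 : 0 < T by exact: powR_gt0.
have ST : 0 <= (S - T) * (a - b).
  have q1p : 0 <= 1 - p by rewrite subr_ge0 ltW.
  have [st|/ltW st] := leP s t.
    by rewrite mulr_le0// subr_le0 ge0_ler_powR// nnegrE ltW.
  by rewrite mulr_ge0// subr_ge0 ge0_ler_powR// nnegrE ltW.
have CS : 0 <= ip x y + s * t.
  have : 0 <= `|t *: x - (- s) *: y| ^+ 2 by rewrite exprn_ge0.
  rewrite E.
  have -> : t ^+ 2 * s ^+ 2 - 2 * t * - s * ip x y + (- s) ^+ 2 * t ^+ 2 =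
      (s * t) * 2 * (ip x y + s * t) by ring.
  by rewrite pmulr_rge0// !mulr_gt0.
have := E 1 1; rewrite !scale1r => ->; rewrite exprMn E.
(* [d] vanishes for antiparallel vectors, and both squared sides are affine in [d]: [h1] settles
   [d = 0], [h2] compares the linear terms. *)
set d := ip x y + s * t in CS.
have -> : ip x y = d - s * t by rewrite /d addrK.
have -> : a^-1 ^+ 2 * s ^+ 2 - 2 * a^-1 * b^-1 * (d - s * t)
    + b^-1 ^+ 2 * t ^+ 2 = (S + T) ^+ 2 - 2 * d / (a * b).
  by rewrite sE tE; field; rewrite !gt_eqF.
have h1 : ((S + T) * ((a + b) / 2)) ^+ 2 <= (s + t) ^+ 2.
  have ST0 := addr_gt0 S0 T0; have st0 := addr_gt0 s0 t0.
  rewrite ler_pXn2r ?nnegrE ?(ltW st0)//; last first.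
    by rewrite mulr_ge0 ?divr_ge0 ?addr_ge0// ltW.
  have -> : s + t = (S + T) * ((a + b) / 2) + (S - T) * (a - b) / 2.
    by rewrite sE tE; field.
  by rewrite lerDl divr_ge0.
have h2 : 2 * d <= 2 * d / (a * b) * ((a + b) / 2) ^+ 2.
  rewrite -mulrA ler_peMr ?mulr_ge0// mulrC ler_pdivlMr ?mulr_gt0//.
  have := sqr_ge0 (a - b); lra.
have -> : 1 ^+ 2 * s ^+ 2 - 2 * 1 * 1 * (d - s * t) + 1 ^+ 2 * t ^+ 2
  = (s + t) ^+ 2 - 2 * d by ring.
rewrite exprMn in h1; rewrite mulrBl; lra.
Qed.

Theorem theorem2p7 (R : realType) (X : normedModType R) (p : R)
    (hp0 : 0 <= p) (hp1 : p < 1) :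
  [<-> forall q : R, 0 < q -> q <= 1 -> angular_bound X p q ;
       exists2 q : R, 0 < q & angular_bound X p q ;
       is_inner_product_space X ].
Proof.
tfae=> [bound|[q q0 bound]|ip q q0 q1].
- by exists 1 => //; apply: bound.
- apply: iso_birkhoff_inner => x y; apply: lorch_birkhoff.
  exact: angular_bound_lorch bound.
- exact: angular_bound_inner.
Qed.
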